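(* Let $(\mathcal{B},\mathcal{L},\theta,\mathcal{I}_\alpha)$ be a generalized Boolean dynamical system and $(E^1,d,r)$ its topological correspondence. The $C^*$-correspondences $C_d(E^1)$ and $M(\mathcal{B},\mathcal{L},\theta,\mathcal{I}_\alpha)$ over $C_0(X_\emptyset)$ defined in the context are isomorphic.
   Context: **Generalized Boolean dynamical systems.** A Boolean algebra $\mathcal{B}$ is a (not necessarily unital) relatively complemented distributive lattice with least element $\emptyset$ and operations $\cap,\cup,\setminus$; $A\subseteq B$ means $A\cap B=A$. An ideal is a non-empty subset closed under finite unions and under intersection with arbitrary elements of $\mathcal{B}$. An action is a map $\mathcal{B}\to\mathcal{B}$ preserving $\cap,\cup,\setminus$ and $\emptyset$. A generalized Boolean dynamical system $(\mathcal{B},\mathcal{L},\theta,\mathcal{I}_\alpha)$ consists of a Boolean algebra $\mathcal{B}$, a set $\mathcal{L}$, actions $\{\theta_\alpha\}_{\alpha\in\mathcal{L}}$ and ideals $\{\mathcal{I}_\alpha\}_{\alpha\in\mathcal{L}}$ with $\{A\in\mathcal{B}:A\subseteq\theta_\alpha(B)\text{ for some }B\in\mathcal{B}\}\subseteq\mathcal{I}_\alpha$ for all $\alpha\in\mathcal{L}$. **Topological correspondence.** $X_\emptyset$ is the space of ultrafilters (maximal filters) in $\mathcal{B}$ with basis $Z(A)=\{\xi\in X_\emptyset:A\in\xi\}$, $A\in\mathcal{B}$; for $\alpha\in\mathcal{L}$, $X_\alpha$ is the space of ultrafilters in $\mathcal{I}_\alpha$ with basis $\{\eta\in X_\alpha:A\in\eta\}$,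 $A\in\mathcal{I}_\alpha$. $F^0=X_\emptyset\cup\{\emptyset\}$, with $\emptyset$ isolated if $\mathcal{B}$ is unital, and $F^0$ the one-point compactification of $X_\emptyset$ (with $\emptyset$ at infinity) otherwise. $E^1=\{e^\alpha_\eta:\alpha\in\mathcal{L},\eta\in X_\alpha\}$ with the disjoint union topology of $\bigsqcup_{\alpha\in\mathcal{L}}X_\alpha$. For $\eta\in X_\alpha$ put $h_{[\alpha]\emptyset}(\eta)=\{B\in\mathcal{B}:A\subseteq B\text{ for some }A\in\eta\}\in X_\emptyset$ and $f_{\emptyset[\alpha]}(\eta)=\{A\in\mathcal{B}:\theta_\alpha(A)\in\eta\}\in F^0$; $d:E^1\to X_\emptyset$, $d(e^\alpha_\eta)=h_{[\alpha]\emptyset}(\eta)$, is a local homeomorphism and $r:E^1\to F^0$, $r(e^\alpha_\eta)=f_{\emptyset[\alpha]}(\eta)$, is continuous. **The $C^*$-correspondence $C_d(E^1)$.** For $p\in C(E^1)$ let $\langle p,p\rangle:X_\emptyset\to[0,\infty]$, $\langle p,p\rangle(v)=\sum_{e\in d^{-1}(v)}|p(e)|^2$. $C_d(E^1)=\{p\in C(E^1):\langle p,p\rangle\in C_0(X_\emptyset)\}$ is a Hilbert $C_0(X_\emptyset)$-module with $\langle p,q\rangle(v)=\sum_{e\in d^{-1}(v)}\overline{p(e)}q(e)$, $(pa)(e)=p(e)a(d(e))$, and left action $(ap)(e)=a(r(e))p(e)$, where $a\in C_0(X_\emptyset)$ is viewed as a function on $F^0$ with $a(\emptyset)=0$. **The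 $C^*$-correspondence $M(\mathcal{B},\mathcal{L},\theta,\mathcal{I}_\alpha)$.** For $A\in\mathcal{B}$ let $\chi_A=1_{Z(A)}\in C_0(X_\emptyset)$. For $\alpha\in\mathcal{L}$ let $M_\alpha=\overline{\mathrm{span}}\{\chi_A:A\in\mathcal{I}_\alpha\}$, an ideal of $C_0(X_\emptyset)$, identified with $C_0(X_\alpha)$ via $m\mapsto m\circ h_{[\alpha]\emptyset}$, with its natural Hilbert module structure. $M(\mathcal{B},\mathcal{L},\theta,\mathcal{I}_\alpha)=\bigoplus_{\alpha\in\mathcal{L}}M_\alpha=\{(m_\alpha)_\alpha\in\prod_\alpha M_\alpha:\sum_\alpha m_\alpha^*m_\alpha\in C_0(X_\emptyset)\}$ (direct sum of Hilbert modules) with $\langle(m_\alpha),(n_\alpha)\rangle=\sum_\alpha m_\alpha^*n_\alpha$, right action $(m_\alpha)\cdot a=(m_\alpha a)$, and left action determined by $\chi_A\cdot(m_\alpha)=(\chi_{\theta_\alpha(A)}m_\alpha)$ for $A\in\mathcal{B}$; more generally $a\cdot(m_\alpha)=((a\circ f_{\emptyset[\alpha]})m_\alpha)$ for $a\in C_0(X_\emptyset)$ (under the identification $M_\alpha\cong C_0(X_\alpha)$, with $a(\emptyset)=0$). *)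

(* Defs.v *)
From HB Require Import structures.
From mathcomp Require Import all_boot all_order all_algebra.
From mathcomp Require Import finmap.
From mathcomp Require Import all_classical all_reals all_analysis.
From mathcomp.analysis Require Import showcase.summability.
From mathcomp Require Import complex.
Set Implicit Arguments.
Unset Strict Implicit.
Unset Printing Implicit Defensive.
Import Order.TTheory Order.CTheory GRing.Theory Num.Theory.
Import numFieldNormedType.Exports.
Local Open Scope classical_set_scope.
Local Open Scope ring_scope.
Local Open Scope complex_scope.

(* The usual topology of the complex numbers: the one MathComp-Analysis puts
   on a numFieldType regarded as a normed module over itself. *)
#[warnings="-redundant-canonical-projection"]
HB.instance Definition _ (R : realType) := NormedModule.copy R[i] R[i]^o.

(* A base point is all that [lim] needs beyond the uniform structure. *)
HB.instance Definition _ (T : choiceType) (A : set T) (V : puniformType) :=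
  isPointed.Build {uniform` A -> V} (fun=> point).

(* A relatively complemented distributive lattice with a least element is a
   [cbDistrLatticeType]; no greatest element is assumed. *)
Section BooleanAlgebra.
Context {disp : Order.disp_t} {B : cbDistrLatticeType disp}.
Implicit Types (a b : B) (I xi : set B).
Local Open Scope order_scope.

Record is_ideal I : Prop := IsIdeal {
  ideal_neq0 : I !=set0;
  ideal_join : forall a b, I a -> I b -> I (a `|` b);
  ideal_meet : forall a b, I a -> I (a `&` b) }.

Record is_action (t : B -> B) : Prop := IsAction {
  action_meet : forall a b, t (a `&` b) = t a `&` t b;
  action_join : forall a b, t (a `|` b) = t a `|` t b;
  action_diff : forall a b, t (a `\` b) = t a `\` t b;
  action_bot : t \bot = \bot }.

(* Filters in the Boolean algebra [I]; for filters in [B] take [I] = setT. *)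
Record is_bfilter I xi : Prop := IsBFilter {
  bfilter_sub : xi `<=` I;
  bfilter_neq0 : xi !=set0;
  bfilter_bot : ~ xi \bot;
  bfilter_meet : forall a b, xi a -> xi b -> xi (a `&` b);
  bfilter_up : forall a b, xi a -> I b -> a <= b -> xi b }.

Definition is_ultrafilter I xi : Prop :=
  is_bfilter I xi /\
  forall zeta, is_bfilter I zeta -> xi `<=` zeta -> zeta = xi.

Record ultra I : Type := Ultra {
  ultra_set : set B;
  ultraP : is_ultrafilter I ultra_set }.

Lemma ultra_inj I (xi zeta : ultra I) :
  ultra_set xi = ultra_set zeta -> xi = zeta.
Proof.
case: xi zeta => [x Px] [y Py] /= exy; rewrite exy in Px *.
by congr Ultra; exact: Prop_irrelevance.
Qed.

HB.instance Definition _ I := gen_eqMixin (ultra I).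
HB.instance Definition _ I := gen_choiceMixin (ultra I).

Definition Zset I a : set (ultra I) := [set xi | ultra_set xi a].
Arguments Zset I a : clear implicits, rename.

Lemma Z_cover I : \bigcup_(V in [set Zset I a | a in I]) V = setT.
Proof.
apply/seteqP; split=> // xi _.
have [[subI [a xa] _ _ _] _] := ultraP xi.
by exists (Zset I a) => //; exists a => //; exact: subI.
Qed.

Lemma Z_join I (V W : set (ultra I)) (xi : ultra I) :
  [set Zset I a | a in I] V -> [set Zset I a | a in I] W -> V xi -> W xi ->
  exists U, [/\ [set Zset I a | a in I] U, U xi & U `<=` (V `&` W)%classic].
Proof.
case=> a Ia <- [b Ib <-] xa xb; exists (Zset I (a `&` b)).
have [[subI _ _ meet _] _] := ultraP xi.
split; [by exists (a `&` b) => //; exact/subI/meet|exact: meet|].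
move=> zeta; have [[_ _ _ _ up] _] := ultraP zeta.
move=> zab; split; [apply: (up _ _ zab Ia)|apply: (up _ _ zab Ib)].
- exact: leIl.
- exact: leIr.
Qed.

HB.instance Definition _ I :=
  isBaseTopological.Build (ultra I) (@Z_cover I) (@Z_join I).

(* A maximal filter is prime. *)
Lemma ultra_prime I (xi : ultra I) a b : is_ideal I ->
  ultra_set xi (a `|` b) -> I a -> I b -> ultra_set xi a \/ ultra_set xi b.
Proof.
move=> idI xab Ia Ib; have [[subI neq0 nbot meet up] maxi] := ultraP xi.
have [[c xc cb0]|nc] := pselect (exists2 c, ultra_set xi c & c `&` b = \bot).
  left; apply: (up _ _ (meet _ _ xc xab) Ia).
  by rewrite meetUr cb0 joinx0 leIr.
right; pose G := [set x | I x /\ exists2 c, ultra_set xi c & c `&` b <= x].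
suff <- : G = ultra_set xi by split => //; exists (a `|` b) => //; exact: leIr.
apply: maxi; last first.
  by move=> c xc; split; [exact: subI|exists c => //; exact: leIl].
split.
- by move=> x [].
- by exists b; split => //; exists (a `|` b) => //; exact: leIr.
- by case=> _ [c xc]; rewrite lex0 => /eqP cb0; apply: nc; exists c.
- move=> x y [Ix [c xc cx]] [Iy [e xe ey]]; split.
    by apply: (ideal_meet idI).
  exists (c `&` e); first exact: meet.
  rewrite lexI; apply/andP; split.
    by apply: le_trans cx; rewrite leI2// leIl.
  by apply: le_trans ey; rewrite leI2// leIr.
- move=> x y [Ix [c xc cx]] Iy xy; split => //.
  by exists c => //; exact: le_trans xy.
Qed.

End BooleanAlgebra.
Arguments Zset {disp B} I a.

Record gbds (disp : Order.disp_t) (B : cbDistrLatticeType disp)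
    (L : choiceType) : Type := GBDS {
  theta : L -> B -> B;
  ideal : L -> set B;
  thetaP : forall l, is_action (theta l);
  idealP : forall l, is_ideal (ideal l);
  theta_ideal : forall l a b, (a <= theta l b)%O -> ideal l a }.

Section TopologicalCorrespondence.
Context {disp : Order.disp_t} {B : cbDistrLatticeType disp} {L : choiceType}.
Variable S : gbds B L.
Local Open Scope order_scope.

Definition X0 : topologicalType := ultra [set: B].
Definition Xl (l : L) : topologicalType := ultra (ideal S l).

Lemma up_ultrafilter l (eta : Xl l) :
  is_ultrafilter setT [set b | exists2 a, ultra_set eta a & a <= b].
Proof.
have [[subI [a0 ea0] nbot meet up] maxi] := ultraP eta.
have idI := idealP S l; split; first split => //.
- by exists a0, a0.
- by case=> a ea; rewrite lex0 => /eqP a0'; apply: nbot; rewrite -a0'.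
- move=> a b [x ex xa] [y ey yb]; exists (x `&` y); first exact: meet.
  exact: leI2.
- by move=> a b [x ex xa] _ ab; exists x => //; exact: le_trans ab.
move=> G [_ Gn0 Gbot Gmeet Gup] subG; apply/seteqP; split => // c Gc.
have eG x : ultra_set eta x -> G x by move=> ex; apply: subG; exists x.
have GI : G `&` ideal S l = ultra_set eta.
  apply: maxi; last by move=> x ex; split; [exact: eG|exact: subI].
  split.
  - by move=> x [].
  - by exists a0; split; [exact: eG|exact: subI].
  - by case.
  - move=> x y [Gx Ix] [Gy _]; split; first exact: Gmeet.
    exact: (ideal_meet idI).
  - by move=> x y [Gx _] Iy xy; split => //; exact: Gup xy.
exists (a0 `&` c); last exact: leIr.
rewrite -GI; split; first by apply: Gmeet => //; exact: eG.
by apply: (ideal_meet idI); exact: subI.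
Qed.

Definition hl (l : L) (eta : Xl l) : X0 := Ultra (up_ultrafilter eta).

Lemma hl_inj l : injective (@hl l).
Proof.
have sub (eta zeta : Xl l) : hl eta = hl zeta ->
    ultra_set eta `<=` ultra_set zeta.
  move=> /(congr1 (@ultra_set _ _ _))/= ez a ea.
  have [[subI _ _ _ _] _] := ultraP eta.
  have : [set b | exists2 a, ultra_set eta a & a <= b] a by exists a.
  rewrite ez => -[c zc ca]; have [[_ _ _ _ up] _] := ultraP zeta.
  exact: up zc (subI _ ea) ca.
by move=> eta zeta ez; apply: ultra_inj; apply/seteqP; split; exact: sub.
Qed.

Definition pullback (l : L) (eta : Xl l) : set B :=
  [set a | ultra_set eta (theta S l a)].

Lemma pullbackP l (eta : Xl l) :
  is_ultrafilter setT (pullback eta) \/ pullback eta = set0.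
Proof.
have [->|/set0P [a0 ea0]] := eqVneq (pullback eta) set0; first by right.
left; have [[subI _ nbot meet up] _] := ultraP eta.
have [tI tU tD t0] := thetaP S l.
have It a : ideal S l (theta S l a) by exact: (@theta_ideal _ _ _ S l _ a).
split; first split => //.
- by exists a0.
- by rewrite /pullback/= t0.
- by move=> a b ea eb; rewrite /pullback/= tI; exact: meet.
- move=> a b ea _ /meet_idPl ab; apply: up ea (It b) _.
  by rewrite -ab tI leIr.
move=> G [_ _ Gbot Gmeet _] subG; apply/seteqP; split => // c Gc.
have : ultra_set eta (theta S l (a0 `&` c) `|` theta S l (a0 `\` c)).
  by rewrite -tU joinIB.
case/(ultra_prime (idealP S l))/(_ (It _) (It _)) => e.
  by apply: up e (It c) _; rewrite tI leIr.
exfalso; apply: Gbot; rewrite -(diffIK a0 c).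
by apply: Gmeet => //; apply: subG.
Qed.

(* The library's one-point compactification of [X0] is [option X0], where the
   neighbourhoods of [None] are the complements of compact closed sets.  Hence
   [None] is isolated when [X0] is compact, i.e. when [B] is unital, so this is
   the space F^0 in both cases, [None] being the point written as the empty
   set. *)
Definition F0 : topologicalType := one_point_compactification X0.

(* By [pullbackP], the second case is exactly [pullback eta = set0]. *)
Definition fl (l : L) (eta : Xl l) : F0 :=
  if pselect (is_ultrafilter setT (pullback eta)) is left P
  then Some (Ultra P) else None.

Definition E1 : topologicalType := {l : L & Xl l}.
Definition dmap (e : E1) : X0 := hl (projT2 e).
Definition rmap (e : E1) : F0 := fl (projT2 e).

End TopologicalCorrespondence.
Arguments X0 {disp} B.
Arguments F0 {disp} B.

Definition C0 (R : realType) (X : topologicalType) : set (X -> R[i]) :=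
  [set a | continuous a /\
    forall eps : R, 0 < eps -> compact [set x | eps%:C <= `|a x|]].
Arguments C0 : clear implicits.

(* The data of a C*-correspondence over C_0(X).  The underlying module is the
   set [carrier] inside a vector space of functions on which the formulas for
   the inner product and the two actions make sense everywhere; only their
   values on [carrier] and [C0 R X] matter. *)
Record correspondence_data (R : realType) (X : topologicalType) : Type :=
  CorrespondenceData {
    ambient : lmodType R[i];
    carrier : set ambient;
    inner : ambient -> ambient -> X -> R[i];
    ract : ambient -> (X -> R[i]) -> ambient;
    lact : (X -> R[i]) -> ambient -> ambient }.
Arguments carrier {R X} _.

Definition isomorphic (R : realType) (X : topologicalType)
    (E F : correspondence_data R X) : Prop :=
  exists U : ambient E -> ambient F,
    [/\ set_bij (carrier E) (carrier F) U,
        (forall (c : R[i]) (x y : ambient E), carrier E x -> carrier E y ->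
           U (c *: x + y) = c *: U x + U y),
        (forall x y : ambient E, carrier E x -> carrier E y ->
           inner (U x) (U y) = inner x y),
        (forall (x : ambient E) (a : X -> R[i]), carrier E x -> C0 R X a ->
           U (ract x a) = ract (U x) a) &
        (forall (a : X -> R[i]) (x : ambient E), C0 R X a -> carrier E x ->
           U (lact a x) = lact a (U x))].

Section Correspondences.
Context {disp : Order.disp_t} {B : cbDistrLatticeType disp} {L : choiceType}.
Variables (S : gbds B L) (R : realType).
Local Notation X0 := (X0 B).
Local Notation E1 := (E1 S).

Definition extend0 (a : X0 -> R[i]) (w : F0 B) : R[i] :=
  if w is Some v then a v else 0.

Definition fiber (v : X0) : set E1 := [set e | dmap e = v].

Definition Cd_sqnorm (p : E1 -> R[i]) (v : X0) : \bar R :=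
  \esum_(e in fiber v) ((complex.Re `|p e| ^+ 2)%:E).

Definition Cd_carrier : set (E1 -> R[i]) :=
  [set p | [/\ continuous p,
    (forall v, Cd_sqnorm p v \is a fin_num) &
    C0 R X0 (fun v => (fine (Cd_sqnorm p v))%:C)]].

(* [sum] is the unordered sum: the limit along the finite subsets. *)
Definition Cd_inner (p q : E1 -> R[i]) (v : X0) : R[i] :=
  summability.sum
    (fun e => if pselect (fiber v e) then (p e)^* * q e else 0 : R[i]).

Definition Cd_corr : correspondence_data R X0 := {|
  ambient := E1 -> R[i];
  carrier := Cd_carrier;
  inner := Cd_inner;
  ract := fun p a => (fun e => p e * a (dmap e)) : E1 -> R[i];
  lact := fun a p => (fun e => extend0 a (rmap e) * p e) : E1 -> R[i] |}.

Definition chi (A : B) : X0 -> R[i] := \1_(Zset setT A).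

Definition chi_span (I : set B) : set (X0 -> R[i]) :=
  [set g | exists n (c : 'I_n -> R[i]) (A : 'I_n -> B),
    (forall k, I (A k)) /\ g = \sum_(k < n) c k *: chi (A k)].

(* Closure for uniform convergence, that is, for the norm of C_0(X0). *)
Definition Ml (l : L) : set {uniform X0 -> R[i]} :=
  closure (chi_span (ideal S l) : set {uniform X0 -> R[i]}).

(* The net of finite partial sums of the pointwise products m_l^* n_l. *)
Definition M_partial (m n : L -> X0 -> R[i]) :
    {fset L} -> {uniform X0 -> R[i]} :=
  partial_sum (fun l => (fun v => (m l v)^* * n l v : R[i]) : X0 -> R[i]).

Definition M_carrier : set (L -> X0 -> R[i]) :=
  [set m | (forall l, Ml l (m l)) /\
    exists2 a : {uniform X0 -> R[i]}, C0 R X0 a &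
      M_partial m m @ totally --> a].

Definition M_inner (m n : L -> X0 -> R[i]) : X0 -> R[i] :=
  lim (M_partial m n @ totally).

(* The inverse of m |-> m \o hl : Ml l -> C_0(Xl l), that is, extension by
   zero along the injective map [hl]. *)
Definition of_Xl (l : L) (g : Xl S l -> R[i]) (v : X0) : R[i] :=
  if pselect (exists eta : Xl S l, hl eta = v) is left P
  then g (projT1 (cid P)) else 0.

Definition M_corr : correspondence_data R X0 := {|
  ambient := L -> X0 -> R[i];
  carrier := M_carrier;
  inner := M_inner;
  ract := fun m a => (fun l v => m l v * a v) : L -> X0 -> R[i];
  lact := fun a m =>
    (fun l => of_Xl (fun eta : Xl S l => extend0 a (fl eta) * m l (hl eta)))
      : L -> X0 -> R[i] |}.

End Correspondences.

(* Main.v *)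
Require Import Defs.
From mathcomp Require Import all_boot all_order all_algebra finmap.
From mathcomp Require Import all_classical all_reals all_analysis.
From mathcomp.analysis Require Import showcase.summability.
From mathcomp Require Import complex lra ring.
Set Implicit Arguments.
Unset Strict Implicit.
Unset Printing Implicit Defensive.
Import Order.TTheory Order.CTheory GRing.Theory Num.Theory.
Import numFieldNormedType.Exports.
Local Open Scope classical_set_scope.
Local Open Scope ring_scope.

(* The isomorphism sends [p] to the family of its restrictions to the sheets
   [Xl l], each extended by zero along the open embedding [hl]; it visibly
   commutes with the pointwise structure, so the work is to match the two
   carriers and the two inner products.

   Given [p] in C_d(E^1), the functions [|p_l|^2] are nonnegative and sum to
   the continuous function <p,p>.  The sum of all but one of them is lower
   semicontinuous, so each of them is also upper semicontinuous, and the
   extension by zero is continuous.  It vanishes at infinity since <p,p> does,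
   and is therefore a uniform limit of combinations of characteristic functions
   of sets in the ideal.  Dini's theorem upgrades the pointwise convergence to
   <p,p> to uniform convergence, and [|zw| <= |z|^2 + |w|^2] transfers the
   uniform Cauchy property to the sums defining the inner products. *)

Existing Instance totally_filter.

(** * Finite partial sums, directed by inclusion of the index sets *)

Section PartialSums.
Context {I : choiceType}.

Lemma partial_sumE (V : zmodType) (x : I -> V) (J : {fset I}) :
  partial_sum x J = \sum_(i <- J) x i.
Proof. by rewrite /partial_sum big_seq_fsetE. Qed.

Lemma totally_ge (J0 : {fset I}) : \forall J \near totally, (J0 `<=` J)%fset.
Proof. by exists J0. Qed.

Lemma partial_sum_fsetD (V : zmodType) (x : I -> V) (J K : {fset I}) :
  (J `<=` K)%fset ->
  partial_sum x K = partial_sum x J + partial_sum x (K `\` J)%fset.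
Proof.
move=> JK; rewrite !partial_sumE (big_fsetID _ (mem J)) /=; congr (_ + _).
  apply: eq_fbigl => i; rewrite !inE /=.
  by case: (boolP (i \in J)) => [/(fsubsetP JK) ->|]; rewrite ?andbF.
by apply: eq_fbigl => i; rewrite !inE /= andbC.
Qed.

Lemma partial_sumD (V : zmodType) (x y : I -> V) (J : {fset I}) :
  partial_sum (fun i => x i + y i) J = partial_sum x J + partial_sum y J.
Proof. exact: big_split. Qed.

Lemma partial_sum_ge0 (R : numDomainType) (x : I -> R) (J : {fset I}) :
  (forall i, 0 <= x i) -> 0 <= partial_sum x J.
Proof. by move=> x0; rewrite /partial_sum sumr_ge0. Qed.

Lemma le_partial_sum (R : numDomainType) (x : I -> R) (J K : {fset I}) :
  (forall i, 0 <= x i) -> (J `<=` K)%fset -> partial_sum x J <= partial_sum x K.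
Proof.
by move=> x0 /partial_sum_fsetD->; rewrite lerDl partial_sum_ge0.
Qed.

End PartialSums.

(** Moves a sum over [L] to a fibre of [dmap]. A finite subset of [I] has the same partial sum as
    the image under [g] of its part in [D], enlarged at will by indices outside the image, where [y]
    vanishes. *)
Lemma cvg_partial_sum_reindex (F : numFieldType) (V : normedModType F)
    (I K : choiceType) (D : set I) (g : I -> K) (y : K -> V) (s : V) :
  set_inj D g -> (forall k, ~ (g @` D) k -> y k = 0) ->
  partial_sum y @ totally --> s ->
  partial_sum (fun i => if pselect (D i) then y (g i) else 0) @ totally --> s.
Proof.
move=> ginj y0 ycvg P /ycvg[A0 _ PA].
have [F0 F0P] : exists F0 : {fset I}, forall k, k \in A0 -> (g @` D) k ->
    exists2 i, i \in F0 & D i /\ g i = k.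
  have [t tP] : exists t : seq I, forall k, k \in (A0 : seq K) -> (g @` D) k ->
      exists2 i, i \in t & D i /\ g i = k.
    elim: (A0 : seq K) => [|k r [t tP]]; first by exists [::].
    have [[i Di gi]|nk] := pselect ((g @` D) k).
      exists (i :: t) => j; rewrite inE => /predU1P[-> _|js Dj].
        by exists i; rewrite ?mem_head.
      by have [e et Pe] := tP _ js Dj; exists e; rewrite // inE et orbT.
    by exists t => j; rewrite inE => /predU1P[-> //|]; exact: tP.
  exists [fset i in t]%fset => k kA gk; have [i it iP] := tP _ kA gk.
  by exists i => //; rewrite inE.
exists F0 => // G F0G /=.
(* [A0] may contain indices outside the image of [D]; adjoining them to [B] gives a set containing
   [A0] without changing the sum. *)
pose gD := g @` D; pose B := [fset g i | i in [fset i in G | `[< D i >]]]%fset.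
suff -> : partial_sum (fun i => if pselect (D i) then y (g i) else 0) G =
    partial_sum y (B `|` [fset k in A0 | ~~ `[< gD k >]])%fset.
  apply: PA => /=; apply/fsubsetP => k kA; rewrite !inE /= kA /=.
  case: asboolP => [gk|]; last by rewrite orbT.
  rewrite orbF; have [i iF [Di <-]] := F0P _ kA gk.
  apply/imfsetP; exists i => //=.
  by rewrite !inE /= (fsubsetP F0G)//; exact/asboolP.
rewrite partial_sumE (partial_sumE y).
transitivity (\sum_(k <- B) y k); last first.
  apply: big_fset_incl; first exact: fsubsetUl.
  by move=> k; rewrite !inE => /orP[->//|/andP[_ /asboolPn gk] _]; exact: y0.
rewrite /B big_imfset/=; last first.
  move=> i j; rewrite !inE => /andP[_ /asboolP Di] /andP[_ /asboolP Dj].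
  by apply: ginj; rewrite inE.
transitivity (\sum_(i <- [fset i in G | `[< D i >]]%fset)
    if pselect (D i) then y (g i) else 0).
  apply/esym; apply: big_fset_incl.
    by apply/fsubsetP => i; rewrite !inE => /andP[].
  by move=> i iG; rewrite !inE iG /= => /asboolPn; case: pselect.
rewrite big_seq [RHS]big_seq; apply: eq_bigr => i.
by rewrite !inE => /andP[_ /asboolP Di]; case: pselect.
Qed.

(** * Unordered sums of nonnegative real functions *)

Section NonnegativeSums.
Context {I : choiceType} {R : realType}.
Implicit Types (f : I -> R) (s : R).

Lemma partial_sum_le_lim f s (J : {fset I}) :
  (forall i, 0 <= f i) -> partial_sum f @ totally --> s -> partial_sum f J <= s.
Proof.
move=> f0 fs; apply: (cvgr_to_ge fs).
by near=> K; apply: le_partial_sum => //; near: K; exact: totally_ge.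
Unshelve. all: by end_near. Qed.

(** The net of partial sums is increasing, so its limit is its supremum. *)
Lemma cvg_partial_sumP f s : (forall i, 0 <= f i) ->
  partial_sum f @ totally --> s <->
  (forall J, partial_sum f J <= s) /\
  (forall e, 0 < e -> exists J, s - e < partial_sum f J).
Proof.
move=> f0; split=> [fs|[fs es]].
  split=> [J|e e0]; first exact: partial_sum_le_lim.
  have /cvgrPdist_lt/(_ _ e0)[J _ /(_ J)/= sJ] := fs; exists J.
  by have := sJ (fsubset_refl _); rewrite ltr_distlC => /andP[].
apply/cvgrPdist_lt => e e0; have [J0 sJ0] := es _ e0.
near=> J; rewrite ger0_norm ?subr_ge0// ltrBlDr -ltrBlDl.
apply: lt_le_trans sJ0 _; apply: le_partial_sum => //.
by near: J; exact: totally_ge.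
Unshelve. all: by end_near. Qed.

(** [Cd_sqnorm] is a supremum of extended reals; this turns it into the convergence of a real
    net. *)
Lemma esum_partial_sumP f s : (forall i, 0 <= f i) ->
  \esum_(i in setT) (f i)%:E = s%:E <-> partial_sum f @ totally --> s.
Proof.
move=> f0; have fE (J : {fset I}) :
    (\sum_(i \in [set` J]) (f i)%:E = (partial_sum f J)%:E)%E.
  by rewrite fsbig_finite//= set_fsetK sumEFin partial_sumE.
rewrite (cvg_partial_sumP _ f0); split=> [fs|[fs es]].
  split=> [J|e e0].
    rewrite -lee_fin -fs -fE; apply: ereal_sup_ubound.
    by exists [set` J] => //; split.
  have : (\esum_(i in setT) (f i)%:E)%E \is a fin_num by rewrite fs.
  move=> /(ub_ereal_sup_adherent e0)[_ [A [finA _] <-]].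
  rewrite -/(esum _ _) fs -EFinB.
  rewrite -(fset_setK finA) fE lte_fin => sA.
  by exists (fset_set A).
apply/eqP; rewrite eq_le; apply/andP; split.
  apply: ge_ereal_sup => _ [A [finA _] <-].
  by rewrite -(fset_setK finA) fE lee_fin.
apply/lee_addgt0Pr => e e0; have [J sJ] := es _ e0.
apply: (@le_trans _ _ (partial_sum f J + e)%:E).
  by rewrite lee_fin -lerBlDr ltW.
rewrite EFinD leeD2r// -fE; apply: ereal_sup_ubound.
by exists [set` J] => //; split.
Qed.

Context {X : topologicalType}.

Lemma cvg_partial_sum_at (f : I -> X -> R) (J : {fset I}) (v : X) :
  (forall i, i \in J -> f i x @[x --> v] --> f i v) ->
  partial_sum (f ^~ x) J @[x --> v] --> partial_sum (f ^~ v) J.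
Proof.
move=> fc; rewrite partial_sumE big_seq.
under eq_fun do rewrite partial_sumE big_seq.
by apply: cvg_big => //; exact: add_continuous.
Qed.

(* Dini's theorem; off the compact set where [a >= e] there is nothing to prove
   since the partial sums are nonnegative. *)
Lemma partial_sum_uniform (f : I -> X -> R) (a : X -> R) :
  (forall i x, 0 <= f i x) -> (forall i, continuous (f i)) -> continuous a ->
  (forall e, 0 < e -> compact [set x | e <= a x]) ->
  (forall x, partial_sum (f ^~ x) @ totally --> a x) ->
  forall e, 0 < e ->
    \forall J \near totally, forall x, a x - e < partial_sum (f ^~ x) J.
Proof.
move=> f0 fc ac acpt fa e e0.
have /compact_near_coveringP/(_ {fset I} totally
  (fun J x => a x - e < partial_sum (f ^~ x) J)) := acpt e e0.
case.
  move=> x _.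
  have [_ /(_ _ (divr_gt0 e0 (ltr0n _ 2)))[J aJ]] :=
    (cvg_partial_sumP (a x) (f0^~ x)).1 (fa x).
  have Jc : continuous (fun x => partial_sum (f ^~ x) J).
    by move=> y; apply: cvg_partial_sum_at => i _; exact: fc.
  (* The slack [e / 2] at [x] and an error [e / 4] from each of the two continuous functions add up
     to [e]. *)
  have : \forall y \near x, a y - e < partial_sum (f ^~ y) J.
    have /cvgrPdist_lt/(_ (e / 4) (divr_gt0 e0 (ltr0n _ 4))) := ac x.
    have /cvgrPdist_lt/(_ (e / 4) (divr_gt0 e0 (ltr0n _ 4))) := Jc x.
    apply: filterS2 => y; rewrite !ltr_distlC => /andP[h1 h2] /andP[h3 h4].
    lra.
  move=> near_x; near=> y K => /=.
  apply: lt_le_trans (_ : partial_sum (f ^~ y) J <= _); first by near: y.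
  by apply: le_partial_sum => //; near: K; exact: totally_ge.
move=> J0 _ J0P; exists J0 => // J /J0P/= aJ x.
have [ea|ae] := leP e (a x); first exact: aJ.
by apply: lt_le_trans (partial_sum_ge0 _ _) => //; rewrite subr_lt0.
Unshelve. all: by end_near. Qed.

(* Each term is both the difference of [a] and the lower semicontinuous sum of
   the others, and nonnegative, so it is small near its zeros. *)
Lemma continuous_summand (f : I -> X -> R) (a : X -> R) (v : X) :
  (forall i x, 0 <= f i x) -> a x @[x --> v] --> a v ->
  (forall x, partial_sum (f ^~ x) @ totally --> a x) ->
  (forall i, f i v = 0 \/ f i x @[x --> v] --> f i v) ->
  forall i, f i x @[x --> v] --> f i v.
Proof.
move=> f0 ac fa fc k; have [fk0|//] := fc k.
apply/cvgrPdist_lt => e e0; rewrite fk0.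
have [_ /(_ _ (divr_gt0 e0 (ltr0n _ 2)))[J aJ]] :=
  (cvg_partial_sumP (a v) (f0^~ v)).1 (fa v).
(* Dropping the indices with [f i v = 0] keeps the sum at [v], leaves only terms continuous at [v],
   and excludes [k]. *)
pose K := [fset i in J | f i v != 0]%fset.
have JK : partial_sum (f ^~ v) J = partial_sum (f ^~ v) K.
  rewrite (partial_sumE _ K) (partial_sumE _ J); apply/esym/big_fset_incl.
    by apply/fsubsetP => i; rewrite !inE => /andP[].
  by move=> i iJ; rewrite !inE iJ/= negbK => /eqP.
have kK : k \notin K by rewrite !inE fk0 eqxx andbF.
have Kc : partial_sum (f ^~ x) K @[x --> v] --> partial_sum (f ^~ v) K.
  apply: cvg_partial_sum_at => i.
  by rewrite !inE => /andP[_ /eqP fi0]; have [] := fc i.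
have /cvgrPdist_lt/(_ (e / 4) (divr_gt0 e0 (ltr0n _ 4))) := ac.
have /cvgrPdist_lt/(_ (e / 4) (divr_gt0 e0 (ltr0n _ 4))) := Kc.
apply: filterS2 => y; rewrite !ltr_distlC => /andP[h1 h2] /andP[h3 h4].
(* With [k] added the partial sum is still at most [a y], so [f k y] is at most [a y] minus the sum
   over [K], which is below [e] near [v]. *)
have := partial_sum_le_lim (k |` K)%fset (f0 ^~ y) (fa y).
rewrite (partial_sumE _ (k |` K)%fset) big_fsetU1//= -partial_sumE => h5.
rewrite JK in aJ; have := f0 k y.
by move=> h6; apply/andP; split; lra.
Qed.

End NonnegativeSums.

(** * Convergence of complex-valued functions, tested with real radii *)

Section ComplexValued.
Context {R : realType}.

Lemma complex_gt0P (e : R[i]) : 0 < e -> exists2 r : R, 0 < r & e = (r%:C)%C.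
Proof.
by case: e => a b; rewrite ltcE/= => /andP[/eqP-> a0]; exists a.
Qed.

Lemma uniform_nbhs_complexP (X : choiceType) (f : {uniform X -> R[i]})
    (P : set {uniform X -> R[i]}) :
  nbhs f P <-> exists2 e : R, 0 < e &
    [set g | forall x, `|f x - g x| < (e%:C)%C] `<=` P.
Proof.
rewrite uniform_nbhs; split=> [[E [entE EP]]|[e e0 eP]].
  move: entE; rewrite -entourage_from_ballE => -[_ /complex_gt0P[e e0 ->] eE].
  by exists e => // g fg; apply: EP => x _; apply: eE; exact: fg.
exists [set xy | ball xy.1 (e%:C)%C xy.2]; split.
  by rewrite -entourage_from_ballE; exists (e%:C)%C => //=; rewrite ltcR.
by move=> g fg; apply: eP => x; exact: fg.
Qed.

Lemma cvg_complexP (T : Type) (F : set_system T) {FF : Filter F}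
    (f : T -> R[i]) (l : R[i]) :
  f @ F --> l <->
  forall e : R, 0 < e -> \forall t \near F, `|l - f t| < (e%:C)%C.
Proof.
rewrite cvgrPdist_lt; split=> fl e; first by move=> e0; apply: fl; rewrite ltcR.
by move=> /complex_gt0P[r r0 ->]; exact: fl.
Qed.

Lemma cvg_at_complexP (X : topologicalType) (f : X -> R[i]) (v : X) :
  f x @[x --> v] --> f v <->
  forall e : R, 0 < e -> \forall x \near v, `|f v - f x| < (e%:C)%C.
Proof. exact: cvg_complexP. Qed.

Lemma cvg_uniform_complexP (X : choiceType) (T : Type) (F : set_system T)
    {FF : Filter F} (f : T -> {uniform X -> R[i]}) (l : {uniform X -> R[i]}) :
  f @ F --> l <-> forall e : R, 0 < e ->
    \forall t \near F, forall x, `|l x - f t x| < (e%:C)%C.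
Proof.
split=> [fl e e0|fl P /uniform_nbhs_complexP[e e0 eP]].
  have := fl [set g | forall x, `|l x - g x| < (e%:C)%C]; apply.
  by apply/uniform_nbhs_complexP; exists e.
by apply: filterS (fl e e0) => t; exact: eP.
Qed.

Lemma normc_ge_Im (z : R[i]) : (`|complex.Im z|%:C)%C <= `|z|.
Proof.
have := normc_ge_Re (z * 'i%C); rewrite ReiNIm normrN normrM.
suff -> : `|'i%C : R[i]| = 1 by rewrite mulr1.
by rewrite normc_def/= expr0n/= add0r expr1n sqrtr1.
Qed.

Lemma normc_le_ReIm (z : R[i]) :
  `|z| <= ((`|complex.Re z| + `|complex.Im z|)%:C)%C.
Proof.
rewrite normc_def lecR -[leRHS]ger0_norm ?addr_ge0// -sqrtr_sqr ler_wsqrtr//.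
by rewrite sqrrD !real_normK ?num_real// lerD2r lerDl mulrn_wge0// mulr_ge0.
Qed.

(** Completeness is inherited from [R]: the real and imaginary parts are additive and bounded by the
    modulus, so they preserve the Cauchy property. *)
Lemma complex_cauchy_cvg (F : set_system R[i]) {FF : ProperFilter F} :
  (forall e : R, 0 < e -> exists z, \forall w \near F, `|z - w| < (e%:C)%C) ->
  exists l : R[i], F --> l.
Proof.
move=> Fcau.
have part (h : R[i] -> R) : (forall z w, h (z - w) = h z - h w) ->
    (forall z, (`|h z|%:C)%C <= `|z|) -> cvg (h @ F).
  move=> hB hle; apply/cauchy_cvgP/cauchy_exP => e e0.
  have [z zF] := Fcau _ e0; exists (h z).
  apply: filterS zF => w zw; rewrite /= -ball_normE/= -hB -ltcR.
  exact: le_lt_trans zw.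
have /cvg_ex[/= a Fa] : cvg (@complex.Re R @ F).
  by apply: part; [case=> ? ? []|exact: normc_ge_Re].
have /cvg_ex[/= b Fb] : cvg (@complex.Im R @ F).
  by apply: part; [case=> ? ? []|exact: normc_ge_Im].
exists (a +i* b)%C; apply/(@cvg_complexP _ F _ id) => e e0.
have e20 : 0 < e / 2 by rewrite divr_gt0.
have /cvgrPdist_lt/(_ _ e20) := Fa; have /cvgrPdist_lt/(_ _ e20) := Fb.
apply: filterS2 => -[c d] /= bd ac.
by apply: le_lt_trans (normc_le_ReIm _) _; rewrite ltcR/=; lra.
Qed.

Lemma cvg_uniform_complex (X : choiceType) (T : Type) (F : set_system T)
    {FF : ProperFilter F} (f : T -> {uniform X -> R[i]}) :
  (forall e : R, 0 < e -> exists g : X -> R[i],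
    \forall t \near F, forall x, `|g x - f t x| < (e%:C)%C) ->
  exists l : {uniform X -> R[i]}, f @ F --> l.
Proof.
move=> fcau.
have /choice[l lP] x : exists l : R[i], (f ^~ x) @ F --> l.
  apply: complex_cauchy_cvg => e /fcau[g gf]; exists (g x).
  by apply: filterS gf => t; exact.
exists l; apply/cvg_uniform_complexP => e e0.
have e40 : 0 < e / 4 by rewrite divr_gt0.
have [g gf] := fcau _ e40; apply: filterS (gf) => t gft x.
(* The index [u] depends on [x] but the condition on [t] does not, which makes the pointwise limit
   uniform. *)
have : \forall u \near F, `|l x - f u x| < ((e / 4)%:C)%C.
  by have /cvg_complexP/(_ _ e40) := lP x.
move=> /(filterI gf)/filter_ex[u [/(_ x) gu lu]].
have -> : l x - f t x = (l x - f u x) - (g x - f u x) + (g x - f t x) by ring.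
apply: le_lt_trans (ler_normD _ _) _.
apply: le_lt_trans (lerD (ler_normB _ _) (lexx _)) _.
apply: lt_le_trans (ltrD (ltrD lu gu) (gft x)) _.
by rewrite -!rmorphD lecR; lra.
Qed.
(** The summand of [Cd_sqnorm], kept real so that order arguments apply to it. *)
Definition sqabs (z : R[i]) : R := complex.Re `|z| ^+ 2.

Lemma sqabs_ge0 z : 0 <= sqabs z.
Proof. exact: sqr_ge0. Qed.

Lemma normc_Re (z : R[i]) : `|z| = ((complex.Re `|z|)%:C)%C.
Proof. by apply/esym/RRe_real/normr_real. Qed.

Lemma normc_ReC (x : R) : `|(x%:C)%C| = (`|x|%:C)%C.
Proof. by rewrite normc_def/= expr0n/= addr0 sqrtr_sqr. Qed.

Lemma Re_norm_ge0 (z : R[i]) : 0 <= complex.Re `|z|.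
Proof. by rewrite -lecR -normc_Re normr_ge0. Qed.

Lemma sqabsE z : ((sqabs z)%:C)%C = (z^*)%C * z.
Proof. by rewrite rmorphXn/= -normc_Re sqr_normc mulrC. Qed.

Lemma sqabs0 : sqabs 0 = 0.
Proof. by rewrite /sqabs normr0 expr0n. Qed.

Lemma le_sqabs (e : R) z : 0 < e -> (e ^+ 2 <= sqabs z) = ((e%:C)%C <= `|z|).
Proof.
by move=> e0; rewrite normc_Re lecR ler_sqr// nnegrE ?Re_norm_ge0// ltW.
Qed.

Lemma lt_sqabs (e : R) z : 0 < e -> (sqabs z < e ^+ 2) = (`|z| < (e%:C)%C).
Proof.
by move=> e0; rewrite normc_Re ltcR ltr_sqr// nnegrE ?Re_norm_ge0// ltW.
Qed.

Lemma continuous_sqabs : continuous sqabs.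
Proof.
suff Rec : continuous (fun z : R[i] => complex.Re `|z|).
  move=> z; exact: (cvgM (Rec z) (Rec z)).
move=> z; apply/(@cvgrPdist_lt _ _ _ (nbhs z)) => e e0.
have /cvg_at_complexP/(_ _ e0) : (id : R[i] -> R[i]) x @[x --> z] --> z by [].
apply: filterS => w /= zw; rewrite -ltcR; apply: le_lt_trans zw.
by rewrite -normc_ReC rmorphB/= -!normc_Re ler_dist_dist.
Qed.

(** Follows from $(|z|-|w|)^2 \ge 0$; it bounds tails of inner products by tails of square norms. *)
Lemma norm_conj_mul z w : `|(z^*)%C * w| <= ((sqabs z + sqabs w)%:C)%C.
Proof.
rewrite normrM normcJ (normc_Re z) (normc_Re w) -rmorphM lecR /sqabs.
have := sqr_ge0 (complex.Re `|z| - complex.Re `|w|).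
have := Re_norm_ge0 z; have := Re_norm_ge0 w.
move: (complex.Re `|z|) (complex.Re `|w|) => x y; nra.
Qed.

End ComplexValued.

(** * Ultrafilters and the topology of their space *)

Section Ultrafilters.
Context {disp : Order.disp_t} {B : cbDistrLatticeType disp}.
Implicit Types (I : set B) (a b : B).
Local Open Scope order_scope.

Lemma is_ideal_setT : is_ideal [set: B].
Proof. by split => //; exists \bot. Qed.

Lemma ideal_diff I a b : is_ideal I -> I a -> I (a `\` b).
Proof.
by move=> idI Ia; rewrite -(meet_l (leBx a b)) meetC; exact: ideal_meet.
Qed.

Lemma ultra_meet I (xi : ultra I) a b :
  ultra_set xi a -> ultra_set xi b -> ultra_set xi (a `&` b).
Proof. by have [[_ _ _ meet _] _] := ultraP xi; exact: meet. Qed.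

Lemma ultra_up I (xi : ultra I) a b :
  ultra_set xi a -> I b -> a <= b -> ultra_set xi b.
Proof. by have [[_ _ _ _ up] _] := ultraP xi; exact: up. Qed.

Lemma ultra_bot I (xi : ultra I) : ~ ultra_set xi \bot.
Proof. by have [[_ _ ? _ _] _] := ultraP xi. Qed.

Lemma ultra_sub I (xi : ultra I) a : ultra_set xi a -> I a.
Proof. by have [[+ _ _ _ _] _] := ultraP xi; apply. Qed.

Lemma ultra_diff I (xi : ultra I) a b : is_ideal I ->
  ultra_set xi a -> I b -> ultra_set xi (a `\` b) <-> ~ ultra_set xi b.
Proof.
move=> idI xa Ib; have Ia := ultra_sub xa; split=> [xab xb|nxb].
  by apply: (@ultra_bot _ xi); rewrite -(diffIK a b); exact: ultra_meet.
have : ultra_set xi ((a `&` b) `|` (a `\` b)) by rewrite joinIB.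
case/(ultra_prime idI) => //; [exact: ideal_meet|exact: ideal_diff|].
by move=> /ultra_up/(_ Ib (leIr _ _)).
Qed.

Lemma ultra_join I (xi : ultra I) a b : is_ideal I -> I a -> I b ->
  ultra_set xi (a `|` b) <-> ultra_set xi a \/ ultra_set xi b.
Proof.
move=> idI Ia Ib; have Iab : I (a `|` b) by apply: ideal_join.
split=> [xab|[xa|xb]]; first exact: ultra_prime.
  exact: ultra_up xa Iab (leUl _ _).
exact: ultra_up xb Iab (leUr _ _).
Qed.

Lemma open_Zset I a : I a -> open (Zset I a).
Proof.
move=> Ia; exists [set Zset I a]; last by rewrite bigcup_set1.
by move=> _ ->; exists a.
Qed.

Lemma nbhs_ultraP I (xi : ultra I) (P : set (ultra I)) :
  nbhs xi P <-> exists2 a, ultra_set xi a & (Zset I a `<=` P)%classic.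
Proof.
split=> [|[a xa aP]].
  rewrite nbhsE => -[V [[D DZ <-] [W DW Wx]] VP].
  have [a Ia aW] := DZ _ DW; exists a; first by move: Wx; rewrite -aW.
  by move=> zeta za; apply: VP; exists W => //; rewrite -aW.
apply: filterS aP _; apply: open_nbhs_nbhs; split=> //.
by apply: open_Zset; exact: ultra_sub xa.
Qed.

Lemma clopen_Zset a : clopen (Zset setT a).
Proof.
split; first exact: open_Zset.
rewrite -openC openE => xi /= nxa; apply/nbhs_ultraP.
(* In the absence of a top element, the complement of [a] is taken relative to some [c] in [xi]. *)
have [[_ [c xc] _ _ _] _] := ultraP xi.
exists (c `\` a) => [|zeta /= zca za].
  by apply/(ultra_diff is_ideal_setT xc).
by apply: (@ultra_bot _ zeta); rewrite -(diffIK c a); exact: ultra_meet.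
Qed.

End Ultrafilters.

(** * The open embedding of [Xl] into [X0] *)

Section Embedding.
Context {disp : Order.disp_t} {B : cbDistrLatticeType disp} {L : choiceType}.
Context (S : gbds B L) (l : L).
Local Open Scope order_scope.

(** The preimage of [xi] is its intersection with the ideal; the range of [hl] thus consists of the
    ultrafilters that meet the ideal. *)
Lemma range_hl (a : B) (xi : X0 B) : ideal S l a -> ultra_set xi a ->
  exists2 eta : Xl S l, hl eta = xi & ultra_set eta a.
Proof.
move=> Ia xa; have idI := idealP S l.
have etaP : is_ultrafilter (ideal S l) (ultra_set xi `&` ideal S l)%classic.
  split; first split.
  - by move=> b [].
  - by exists a.
  - by case=> /ultra_bot.
  - by move=> b c [xb Ib] [xc _]; split; [exact: ultra_meet|exact: ideal_meet].
  - by move=> b c [xb _] Ic bc; split => //; exact: ultra_up xb _ bc.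
  move=> G [subI _ nbot meet _] subG; apply/seteqP; split=> // c Gc.
  split; last exact: subI.
  (* Otherwise the difference of [a] and [c] lies in [xi] and in the ideal, hence in [G], although
     its meet with [c] is bottom. *)
  apply: contrapT => nxc; apply: nbot; rewrite -(diffIK a c).
  apply: meet => //; apply: subG; split; last exact: ideal_diff.
  by apply/ultra_diff => //; exact: is_ideal_setT.
exists (Ultra etaP) => //; apply: ultra_inj; apply/seteqP; split=> b /=.
  by case=> c [xc _] cb; exact: ultra_up xc _ cb.
move=> xb; exists (a `&` b); last exact: leIr.
by split; [exact: ultra_meet|exact: ideal_meet].
Qed.

(** For [a] in the ideal, [hl] maps the basic set of [a] in [Xl] onto that in [X0], so [hl] is both
    continuous and open. *)
Lemma nbhs_hl (eta : Xl S l) (P : set (X0 B)) :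
  nbhs (hl eta) P <-> nbhs eta (@hl _ _ _ S l @^-1` P)%classic.
Proof.
split=> /nbhs_ultraP[a ea aP]; apply/nbhs_ultraP.
  case: ea => b eb ba; exists b => // zeta zb; apply: aP; by exists b.
exists a; first by exists a.
move=> xi xa; have [zeta <- za] := range_hl (ultra_sub ea) xa.
exact: aP.
Qed.

End Embedding.

(** * Characteristic functions and their span *)

Section ChiSpan.
Context {disp : Order.disp_t} {B : cbDistrLatticeType disp}.
Context {R : realType}.
Local Notation chi := (@chi disp B R).

Lemma chiE (a : B) v : chi a v = (`[< ultra_set v a >])%:R.
Proof. by rewrite /Defs.chi indicE; congr (_ %:R); rewrite in_setE. Qed.

Lemma continuous_chi (a : B) : continuous (chi a).
Proof.
have [oa ca] := clopen_Zset a => v; rewrite -openC in ca.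
suff : \forall x \near v, chi a x = chi a v.
  by move=> ?; apply: (@cvg_near_cst _ _ (chi a v) (chi a) (nbhs v)).
rewrite [chi a v]chiE; case: asboolP => va.
  have : nbhs v (Zset setT a) by apply: open_nbhs_nbhs.
  by apply: filterS => w wa /=; rewrite chiE asboolT.
have : nbhs v (~` Zset setT a) by apply: open_nbhs_nbhs.
by apply: filterS => w wa /=; rewrite chiE asboolF.
Qed.

Context (I : set B).

Lemma chi_span0 : chi_span I (0 : X0 B -> R[i]).
Proof.
by exists 0%N, (fun=> 0), (fun=> \bot%O); split=> [[]//|]; rewrite big_ord0.
Qed.

Lemma chi_span_add (h : X0 B -> R[i]) (c : R[i]) (a : B) :
  chi_span I h -> I a -> chi_span I (c *: chi a + h).
Proof.
move=> [n [d [A [IA ->]]]] Ia.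
exists n.+1, (fun k => oapp d c (unlift ord0 k)),
  (fun k => oapp A a (unlift ord0 k)); split=> [k|].
  by case: (unlift ord0 k).
rewrite big_ord_recl unlift_none; congr (_ + _).
by apply: eq_bigr => k _; rewrite liftK.
Qed.

End ChiSpan.

(** * [Ml] and functions vanishing off the range of [hl] *)

Section Ml.
Context {disp : Order.disp_t} {B : cbDistrLatticeType disp} {L : choiceType}.
Context (S : gbds B L) (R : realType) (l : L).
Implicit Types g h : X0 B -> R[i].

Lemma MlP g : Ml S l g <-> forall e : R, 0 < e ->
  exists2 h, chi_span (ideal S l) h & forall v, `|g v - h v| < (e%:C)%C.
Proof.
split=> [clg e e0|clg P /uniform_nbhs_complexP[e e0 eP]].
  have [|h [hI gh]] := clg [set h | forall x, `|g x - h x| < (e%:C)%C].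
    by apply/uniform_nbhs_complexP; exists e.
  by exists h.
by have [h hI gh] := clg _ e0; exists h; split => //; exact: eP.
Qed.

Lemma chi_span_continuous (I : set B) g : chi_span I g -> continuous g.
Proof.
move=> [n [c [A [_ ->]]]]; rewrite fct_sumE.
apply: continuous_big => [|k _ v]; first exact: add_continuous.
exact: (cvgZr (k:=c k) (@continuous_chi _ _ R (A k) v)).
Qed.

Lemma chi_span_out g v : chi_span (ideal S l) g ->
  ~ (exists eta : Xl S l, hl eta = v) -> g v = 0.
Proof.
move=> [n [c [A [IA ->]]]] nv; rewrite fct_sumE big1// => k _.
rewrite fctE chiE asboolF ?scaler0// => vA; apply: nv.
by have [eta] := range_hl (IA k) vA; exists eta.
Qed.

Lemma Ml_continuous g : Ml S l g -> continuous g.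
Proof.
move=> /MlP gM v; apply/(cvg_at_complexP g v) => e e0.
have e30 : 0 < e / 3 by rewrite divr_gt0.
have [h /chi_span_continuous hc gh] := gM _ e30.
have /cvg_at_complexP/(_ _ e30) := hc v.
apply: filterS => w hvw.
have -> : g v - g w = (g v - h v) - (g w - h w) + (h v - h w) by ring.
apply: le_lt_trans (ler_normD _ _) _.
apply: le_lt_trans (lerD (ler_normB _ _) (lexx _)) _.
apply: lt_le_trans (ltrD (ltrD (gh v) (gh w)) hvw) _.
by rewrite -!rmorphD lecR; lra.
Qed.

Lemma Ml_out g v : Ml S l g ->
  ~ (exists eta : Xl S l, hl eta = v) -> g v = 0.
Proof.
move=> /MlP gM nv; apply/eqP; rewrite -normr_le0.
apply/ler_addgt0Pr => _ /complex_gt0P[e e0 ->]; rewrite add0r ltW//.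
have [h /chi_span_out/(_ nv) hv /(_ v)] := gM _ e0.
by rewrite hv subr0.
Qed.

(** By compactness, finitely many basic sets from the ideal, on each of which [g] is nearly
    constant, cover the set where $|g| \ge e$. A step function on their union is then within [e] of
    [g] everywhere. *)
Lemma in_Ml g : continuous g ->
  (forall v, ~ (exists eta : Xl S l, hl eta = v) -> g v = 0) ->
  (forall e : R, 0 < e -> compact [set v | (e%:C)%C <= `|g v|]) ->
  Ml S l g.
Proof.
move=> gc gout gcpt; apply/MlP => e e0.
set K := [set v | (e%:C)%C <= `|g v|].
have idI := idealP S l.
(* On [K] the value [g x] is nonzero, so [x] is in the range of [hl] and the neighbourhood shrinks
   to an element of the ideal. Off [K] the choice [\bot] is a mere default. *)
have /choice[A AP] x : exists a, K x -> [/\ ideal S l a, ultra_set x a &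
    forall y, ultra_set y a -> `|g x - g y| < (e%:C)%C].
  have [Kx|nKx] := pselect (K x); last by exists \bot%O.
  have [eta etax] : exists eta : Xl S l, hl eta = x.
    apply: contrapT => /gout gx0; move: Kx; rewrite /K/= gx0 normr0.
    by rewrite lecR leNgt e0.
  have /cvg_at_complexP/(_ _ e0)/nbhs_ultraP[b xb bg] := gc x.
  move: xb; rewrite -etax => -[a ea ab].
  exists a => _; split; [exact: ultra_sub ea|by exists a|].
  by move=> y ya; rewrite etax; apply: bg; exact: ultra_up ya _ ab.
have /compact_near_coveringP/(_ {fset X0 B} totally
  (fun J y => exists x, [/\ x \in J, K x & ultra_set y (A x)])) := gcpt _ e0.
case.
  move=> x Kx; have [_ xA _] := AP _ Kx.
  exists ([set y | ultra_set y (A x)], [set J | [fset x] `<=` J]%fset).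
    split=> /=; first by apply/nbhs_ultraP; exists (A x).
    exact: totally_ge.
  case=> y J [/= yA xJ]; exists x; split=> //.
  by apply: (fsubsetP xJ); rewrite inE.
move=> J _ /(_ J (fsubset_refl _)) KJ.
(* Relative differences make the finite cover by the sets [Z (A x)] disjoint,
   so that [h] may be built one block at a time. *)
have approx (s : seq (X0 B)) : exists a h, [/\ ideal S l a,
    chi_span (ideal S l) h,
    (forall x, x \in s -> K x ->
      forall y : X0 B, ultra_set y (A x) -> ultra_set y a),
    (forall y, ultra_set y a -> `|g y - h y| < (e%:C)%C) &
    (forall y, ~ ultra_set y a -> h y = 0)].
  elim: s => [|x s [a [h [Ia hI sa ha hna]]]].
    exists \bot%O, 0; split=> //; [|exact: chi_span0|by move=> y /ultra_bot].
    have [b Ib] := ideal_neq0 idI; rewrite -(meetx0 b).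
    exact: ideal_meet.
  have [Kx|nKx] := pselect (K x); last first.
    exists a, h; split=> // z; rewrite inE => /predU1P[->//|].
    exact: sa.
  have [IAx xA gx] := AP _ Kx; have idT := @is_ideal_setT _ B.
  exists (a `|` A x)%O, (g x *: chi R (A x `\` a)%O + h).
  have joinP (y : X0 B) : ultra_set y (a `|` A x)%O <->
      ultra_set y a \/ ultra_set y (A x).
    exact: ultra_join.
  split.
  - exact: ideal_join.
  - by apply: chi_span_add => //; exact: ideal_diff.
  - move=> z; rewrite inE => /predU1P[-> _ y yA|zs Kz y yA]; apply/joinP.
      by right.
    by left; exact: sa yA.
  (* Over [a] the new term vanishes and [h] is already close to [g]; over the rest of [A x], [h] is
     zero and [g x] is close to [g y]. *)
  - move=> y yaA; rewrite fctE /= fctE chiE.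
    have [ya|nya] := pselect (ultra_set y a).
      rewrite asboolF ?scaler0 ?add0r; first exact: ha.
      move=> yd; apply: (@ultra_bot _ _ _ y).
      by rewrite -(diffIK (A x) a); exact: ultra_meet.
    have [//|yA] := (joinP _).1 yaA; rewrite asboolT; last exact/ultra_diff.
    by rewrite hna// addr0 /GRing.scale/= mulr1 distrC gx.
  - move=> y nyaA; rewrite fctE /= fctE chiE hna ?addr0; last first.
      by move=> ya; apply: nyaA; apply/joinP; left.
    rewrite asboolF ?scaler0// => yd; apply: nyaA; apply/joinP; right.
    by apply: ultra_up yd _ (leBx _ _).
have [a [h [Ia hI Ja ha hna]]] := approx J.
exists h => // v; have [va|nva] := pselect (ultra_set v a); first exact: ha.
rewrite hna// subr0 real_ltNge ?normr_real//; last exact/complex_realP/ex_intro.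
apply/negP => Kv; apply: nva.
by have [x [xJ Kx vA]] := KJ _ Kv; exact: Ja Kx _ vA.
Qed.

End Ml.

(** * The isomorphism between the two correspondences *)

Section Isomorphism.
Context {disp : Order.disp_t} {B : cbDistrLatticeType disp} {L : choiceType}.
Context (S : gbds B L) (R : realType).
Local Notation X0 := (X0 B).
Local Notation E1 := (E1 S).
Implicit Types (p q : E1 -> R[i]) (m n : L -> X0 -> R[i]).

Lemma of_Xl_hl l (g : Xl S l -> R[i]) eta : of_Xl g (hl eta) = g eta.
Proof.
rewrite /of_Xl; case: pselect => [P|[]]; last by exists eta.
by case: (cid P) => zeta /= /hl_inj->.
Qed.

Lemma of_Xl_out l (g : Xl S l -> R[i]) v :
  ~ (exists eta : Xl S l, hl eta = v) -> of_Xl g v = 0.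
Proof. by rewrite /of_Xl; case: pselect. Qed.

Lemma of_Xl_linear l (c : R[i]) (g h : Xl S l -> R[i]) v :
  of_Xl (fun eta => c *: g eta + h eta) v = c *: of_Xl g v + of_Xl h v.
Proof.
by rewrite /of_Xl; case: pselect => // _; rewrite scaler0 addr0.
Qed.

Definition Cd_to_M p : L -> X0 -> R[i] :=
  fun l => of_Xl (fun eta : Xl S l => p (existT _ l eta)).

Definition M_to_Cd m : E1 -> R[i] := fun e => m (projT1 e) (dmap e).

Lemma Cd_to_M_dmap p (e : E1) : Cd_to_M p (projT1 e) (dmap e) = p e.
Proof. by case: e => l eta; rewrite /Cd_to_M of_Xl_hl. Qed.

Lemma Cd_to_MK p : M_to_Cd (Cd_to_M p) = p.
Proof. by apply/funext => e; exact: Cd_to_M_dmap. Qed.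

Lemma M_to_CdK m :
  (forall l v, ~ (exists eta : Xl S l, hl eta = v) -> m l v = 0) ->
  Cd_to_M (M_to_Cd m) = m.
Proof.
move=> m0; apply/funext => l; apply/funext => v.
have [[eta <-]|nv] := pselect (exists eta : Xl S l, hl eta = v).
  by rewrite /Cd_to_M of_Xl_hl.
by rewrite /Cd_to_M of_Xl_out// m0.
Qed.

(** As each [hl] is injective, a fibre of [dmap] meets every sheet at most once, so sums over it can
    be indexed by [L]. *)
Lemma projT1_fiber_inj v : set_inj (fiber v) (@projT1 _ _ : E1 -> L).
Proof.
move=> [l eta] [k zeta]; rewrite !inE /= => ev zv lk.
move: zeta zv; rewrite -lk => zeta zv.
by have -> : eta = zeta by apply: hl_inj; exact: etrans ev (esym zv).
Qed.

Lemma Cd_to_M_fiber p l v : ~ ((@projT1 _ _ : E1 -> L) @` fiber v) l ->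
  Cd_to_M p l v = 0.
Proof.
move=> nl; apply: of_Xl_out => -[eta etav]; apply: nl.
by exists (existT _ l eta).
Qed.

(** Sheets that miss the fibre contribute zero, thanks to the extension by zero. *)
Lemma Cd_sqnormE p v :
  Cd_sqnorm p v = \esum_(l in setT) (sqabs (Cd_to_M p l v))%:E.
Proof.
rewrite /Cd_sqnorm.
rewrite (eq_esum (b := fun e => (sqabs (Cd_to_M p (projT1 e) v))%:E)).
  rewrite -(reindex_esum _ _ _ (fun l => (sqabs (Cd_to_M p l v))%:E)
    (inj_bij (projT1_fiber_inj (v := v)))).
  rewrite esum_mkcond; apply: eq_esum => l _; case: ifPn => //.
  by rewrite notin_setE => /Cd_to_M_fiber->; rewrite sqabs0.
by move=> e <-; rewrite Cd_to_M_dmap.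
Qed.

Lemma C0_real (a : X0 -> R) : (forall v, 0 <= a v) ->
  C0 R X0 (fun v => ((a v)%:C)%C) ->
  continuous a /\ forall e, 0 < e -> compact [set v | e <= a v].
Proof.
move=> a0 [ac acpt]; split=> [v|e /acpt].
  have /cvg_at_complexP av := ac v.
  apply/(@cvgrPdist_lt _ _ _ (nbhs v) _ a) => e /av.
  by apply: filterS => w; rewrite -rmorphB normc_ReC ltcR.
suff -> : [set x | (e%:C)%C <= `|((a x)%:C)%C|] = [set v | e <= a v] by [].
by apply/seteqP; split=> v /=; rewrite normc_ReC lecR ger0_norm.
Qed.

(** * The sheets of one element of C_d(E^1) *)

Section Summable.
Context (p : E1 -> R[i]) (pC : Cd_carrier p).
Let a v := fine (Cd_sqnorm p v).
Let f l v := sqabs (Cd_to_M p l v).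

Lemma Cd_sum v : partial_sum (f ^~ v) @ totally --> a v.
Proof.
apply/esum_partial_sumP; first by move=> l; exact: sqabs_ge0.
by have [_ pfin _] := pC; rewrite /a fineK// Cd_sqnormE.
Qed.

Lemma Cd_sqnorm_C0 :
  continuous a /\ forall e, 0 < e -> compact [set v | e <= a v].
Proof.
have [_ _ aC] := pC; apply: C0_real => // v.
rewrite /a fine_ge0// Cd_sqnormE esum_ge0// => l _.
by rewrite lee_fin sqabs_ge0.
Qed.

(** Since [hl] is open, continuity at a point of its range is that of [p] on the sheet. *)
Lemma Cd_to_M_cvg_range l (eta : Xl S l) :
  Cd_to_M p l x @[x --> hl eta] --> Cd_to_M p l (hl eta).
Proof.
have [pc _ _] := pC; apply/cvg_at_complexP => e e0; apply/nbhs_hl.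
have /cvg_at_complexP/(_ _ e0) := pc (existT _ l eta).
apply: (@filterS _ (nbhs eta)) => zeta /=; rewrite /Cd_to_M !of_Xl_hl; exact.
Qed.

Lemma continuous_sqabs_Cd_to_M l : continuous (f l).
Proof.
move=> v; apply: (continuous_summand (a := a)) => //.
- by move=> k x; exact: sqabs_ge0.
- exact: (Cd_sqnorm_C0.1).
- exact: Cd_sum.
(* Continuity is known beforehand only on the range of [hl]; elsewhere the value is zero, the other
   alternative in [continuous_summand]. *)
move=> k; have [[eta <-]|nv] := pselect (exists eta : Xl S k, hl eta = v).
  right; apply: (@cvg_comp _ _ _ (Cd_to_M p k) sqabs).
    exact: Cd_to_M_cvg_range.
  exact: continuous_sqabs.
by left; rewrite /f /Cd_to_M of_Xl_out// sqabs0.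
Qed.

Lemma continuous_Cd_to_M l : continuous (Cd_to_M p l).
Proof.
move=> v; have [[eta <-]|nv] := pselect (exists eta : Xl S l, hl eta = v).
  exact: Cd_to_M_cvg_range.
apply/(cvg_at_complexP (Cd_to_M p l)) => e e0.
have g0 : Cd_to_M p l v = 0 by rewrite /Cd_to_M of_Xl_out.
(* Where the value is zero, continuity of the squared modulus already gives that of the function. *)
have /(@cvgrPdist_lt _ _ _ (nbhs v) _ (f l)) fc :=
  @continuous_sqabs_Cd_to_M l v.
apply: filterS (fc _ (exprn_gt0 2 e0)) => w.
rewrite /f g0 sqabs0 !sub0r !normrN ger0_norm ?sqabs_ge0//.
by rewrite lt_sqabs.
Qed.

Lemma Cd_to_M_in_Ml l : Ml S l (Cd_to_M p l).
Proof.
apply: in_Ml; first exact: continuous_Cd_to_M.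
  by move=> v nv; rewrite /Cd_to_M of_Xl_out.
(* One summand is at most the whole sum, so this closed set lies in the compact set where $\langle
   p,p\rangle \ge e^2$. *)
move=> e e0; rewrite (_ : [set v | _] = f l @^-1` [set x | e ^+ 2 <= x]).
  have [_ /(_ _ (exprn_gt0 2 e0)) acpt] := Cd_sqnorm_C0.
  apply: (subclosed_compact _ acpt).
    apply: closed_comp (@closed_ge _ _) => v _.
    exact: continuous_sqabs_Cd_to_M.
  move=> v /= ev; apply: le_trans ev _.
  have := partial_sum_le_lim [fset l]%fset (fun k => sqabs_ge0 _) (@Cd_sum v).
  by rewrite partial_sumE big_seq_fset1.
by apply/seteqP; split=> v /=; rewrite le_sqabs.
Qed.

Lemma Cd_sum_uniform e : 0 < e ->
  \forall J \near totally, forall v, a v - e < partial_sum (f ^~ v) J.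
Proof.
have [ac acpt] := Cd_sqnorm_C0.
apply: partial_sum_uniform => //; [by move=> *; exact: sqabs_ge0|..].
  exact: continuous_sqabs_Cd_to_M.
exact: Cd_sum.
Qed.

End Summable.

Lemma M_partialE m n (J : {fset L}) v :
  M_partial m n J v = partial_sum (fun l => ((m l v)^*)%C * n l v) J.
Proof. by rewrite /M_partial /partial_sum fct_sumE. Qed.

Lemma M_partial_sqabs m (J : {fset L}) v :
  M_partial m m J v = ((partial_sum (fun l => sqabs (m l v)) J)%:C)%C.
Proof.
rewrite M_partialE /partial_sum rmorph_sum; apply: eq_bigr => l _.
by rewrite -sqabsE.
Qed.

Lemma Cd_to_M_carrier p : Cd_carrier p -> M_carrier S (Cd_to_M p).
Proof.
move=> pC; split; first exact: Cd_to_M_in_Ml.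
exists (fun v => ((fine (Cd_sqnorm p v))%:C)%C); first by have [] := pC.
apply/cvg_uniform_complexP => e e0.
apply: filterS (Cd_sum_uniform pC e0) => J aJ v.
rewrite M_partial_sqabs -rmorphB normc_ReC ltcR ger0_norm.
  by have := aJ v; lra.
rewrite subr_ge0; apply: partial_sum_le_lim; last exact: Cd_sum.
by move=> l; exact: sqabs_ge0.
Qed.

(** The uniform limit [a] is identified pointwise with the square norm, which thereby is finite and
    inherits membership in [C0]. *)
Lemma M_to_Cd_carrier m : M_carrier S m -> Cd_carrier (M_to_Cd m).
Proof.
move=> [mM [a aC ma]].
have mK : Cd_to_M (M_to_Cd m) = m.
  by apply: M_to_CdK => l v; apply: Ml_out; exact: mM.
have mav (v : X0) (e : R) : 0 < e -> \forall J \near totally,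
    `|a v - ((partial_sum (fun l => sqabs (m l v)) J)%:C)%C| < (e%:C)%C.
  have /cvg_uniform_complexP mae := ma.
  by move=> /mae; apply: filterS => J /(_ v); rewrite M_partial_sqabs.
(* [a] is a priori complex-valued; its imaginary part is bounded by the distance to the real partial
   sums. *)
have aR v : a v = ((complex.Re (a v))%:C)%C.
  suff : complex.Im (a v) = 0 by case: (a v) => x y /= ->.
  apply/eqP; rewrite -normr_le0.
  apply/ler_addgt0Pr => e e0; rewrite add0r ltW//.
  have /filter_ex[J aJ] := mav v _ e0.
  rewrite -ltcR; apply: le_lt_trans aJ; apply: le_trans (normc_ge_Im _).
  by rewrite lecR; case: (a v) => x y /=; rewrite subr0.
have am v : Cd_sqnorm (M_to_Cd m) v = (complex.Re (a v))%:E.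
  rewrite Cd_sqnormE mK; apply/esum_partial_sumP.
    by move=> l; exact: sqabs_ge0.
  apply/cvgrPdist_lt => e e0; apply: filterS (mav v _ e0) => J.
  by rewrite {1}aR -rmorphB normc_ReC ltcR.
split.
- move=> [l eta]; apply/cvg_at_complexP => e e0.
  have /cvg_at_complexP/(_ _ e0)/nbhs_hl :=
    @Ml_continuous _ _ _ _ _ _ _ (mM l) (hl eta).
  (* Neighbourhoods in the disjoint union are those within the sheet. *)
  by rewrite [X in _ -> X]/nbhs/= /sigT_nbhs/=.
- by move=> v; rewrite am.
- rewrite (_ : (fun v => _) = a)//; apply/funext => v.
  by rewrite am /= -aR.
Qed.

(** [M_inner] is defined by [lim], which has the intended meaning only once the net converges. *)
Lemma M_inner_cvg p q : Cd_carrier p -> Cd_carrier q ->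
  M_partial (Cd_to_M p) (Cd_to_M q) @ totally
    --> (M_inner (Cd_to_M p) (Cd_to_M q) : {uniform X0 -> R[i]}).
Proof.
move=> pC qC; suff [l lP] : exists l : {uniform X0 -> R[i]},
    M_partial (Cd_to_M p) (Cd_to_M q) @ totally --> l.
  by apply: (cvgP l).
apply: cvg_uniform_complex => e e0.
have e20 : 0 < e / 2 by rewrite divr_gt0.
have pn := Cd_sum_uniform pC e20; have qn := Cd_sum_uniform qC e20.
have [J [pJ qJ]] := filter_ex (filterI pn qn).
exists (M_partial (Cd_to_M p) (Cd_to_M q) J).
apply: filterS (totally_ge J) => K JK v.
(* The difference is the sum over the indices of [K] outside [J], bounded by the tails of both
   square norms, each below [e / 2]. *)
rewrite distrC !M_partialE (partial_sum_fsetD _ JK) addrC addKr.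
apply: (@le_lt_trans _ _ ((partial_sum (fun l => sqabs (Cd_to_M p l v) +
    sqabs (Cd_to_M q l v)) (K `\` J)%fset)%:C)%C).
  rewrite /partial_sum rmorph_sum; apply: le_trans (ler_norm_sum _ _ _) _.
  by apply: ler_sum => l _; exact: norm_conj_mul.
rewrite ltcR partial_sumD.
have := partial_sum_le_lim K (fun=> sqabs_ge0 _) (@Cd_sum _ pC v).
have := partial_sum_le_lim K (fun=> sqabs_ge0 _) (@Cd_sum _ qC v).
rewrite !(partial_sum_fsetD _ JK); have := pJ v; have := qJ v.
lra.
Qed.

(** The uniform limit over [L] is also a pointwise one, and the latter can be reindexed by the
    fibre. *)
Lemma inner_Cd_to_M p q : Cd_carrier p -> Cd_carrier q ->
  M_inner (Cd_to_M p) (Cd_to_M q) = Cd_inner p q.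
Proof.
move=> pC qC; apply/funext => v; apply/esym.
have /cvg_uniform_complexP innerP := M_inner_cvg pC qC.
rewrite /Cd_inner /summability.sum; apply: cvg_lim.
  exact: norm_hausdorff.
rewrite (_ : (fun e => _) = fun e : E1 => if pselect (fiber v e)
    then ((Cd_to_M p (projT1 e) v)^*)%C * Cd_to_M q (projT1 e) v else 0).
  apply: (@cvg_partial_sum_reindex _ _ _ _ _ (@projT1 _ _)
    (fun l => ((Cd_to_M p l v)^*)%C * Cd_to_M q l v)).
  - exact: projT1_fiber_inj.
  - by move=> l /(@Cd_to_M_fiber q)->; rewrite mulr0.
  - apply/cvg_complexP => e /innerP; apply: filterS => J /(_ v).
    by rewrite M_partialE.
apply/funext => e; case: pselect => // ev.
rewrite /= -(Cd_to_M_dmap p e) -(Cd_to_M_dmap q e).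
by have -> : dmap e = v by [].
Qed.

End Isomorphism.

Theorem proposition7p2 (disp : Order.disp_t) (B : cbDistrLatticeType disp)
  (L : choiceType) (S : gbds B L) (R : realType) :
  isomorphic (Cd_corr S R) (M_corr S R).
Proof.
exists (@Cd_to_M _ _ _ S R); split.
- split=> [p|p q _ _ pq|m mC].
  + exact: Cd_to_M_carrier.
  + by rewrite -[p]Cd_to_MK -[q]Cd_to_MK pq.
  + exists (M_to_Cd m); first exact: M_to_Cd_carrier.
    (* Elements of [Ml] vanish off the range of [hl], so extension by zero recovers them from their
       restrictions. *)
    by apply: M_to_CdK => l v; apply: Ml_out; exact: mC.1.
- move=> c p q _ _; apply/funext => l; apply/funext => v.
  exact: of_Xl_linear.
- by move=> p q; exact: inner_Cd_to_M.
- move=> p a _ _; apply/funext => l; apply/funext => v /=.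
  have [[eta <-]|nv] := pselect (exists eta : Xl S l, hl eta = v).
    by rewrite /Cd_to_M !of_Xl_hl.
  by rewrite /Cd_to_M !of_Xl_out ?mul0r.
- move=> a p _ _; apply/funext => l /=; rewrite /Cd_to_M; congr of_Xl.
  by apply/funext => eta; rewrite of_Xl_hl.
Qed.
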